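(* Let $\phi = \frac{1+\sqrt5}{2}$, $a(k) = \lfloor k\phi\rfloor$, $b(k) = \lfloor k\phi^2\rfloor$, $A = \{a(k)\}_{k\ge1}$, $B = \{b(k)\}_{k \ge 1}$. Let $D = \{3a(k)+k : k \ge 1\}$, $C = D \pm 2$ and $S = C \pm 1$, and let $d(k)$, $c(k)$, $s(k)$ denote the $k$-th smallest elements of $D$, $C$, $S$ respectively. Then for every $k \ge 1$, \[ (s(k),c(k),d(k)) \in (A\times A\times A)\cup(A\times A\times B)\cup(A\times B\times A)\cup(B\times A\times A)\cup(B\times B\times A)\cup(B\times A\times B). \]
   Context: For a set $X$ of integers and an integer $r$, $X \pm r = \{x+r : x\in X\}\cup\{x-r : x \in X\}$. The sets $A$ and $B$ partition the positive integers (Beatty's theorem), and $D, C, S$ partition the positive integers. *)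

(* Defs.v *)
From mathcomp Require Import all_boot all_order all_algebra.
From mathcomp Require Import all_classical all_reals.

Set Implicit Arguments.
Unset Strict Implicit.
Unset Printing Implicit Defensive.

Import Order.TTheory GRing.Theory Num.Theory.
Local Open Scope classical_set_scope.
Local Open Scope card_scope.
Local Open Scope ring_scope.

Definition phi (R : realType) : R := (1 + Num.sqrt 5) / 2.

Definition aseq (R : realType) (k : nat) : int := Num.floor (k%:R * phi R).
Definition bseq (R : realType) (k : nat) : int := Num.floor (k%:R * phi R ^+ 2).

Definition Aset (R : realType) : set int :=
  [set aseq R k | k in [set k | (1 <= k)%N]].
Definition Bset (R : realType) : set int :=
  [set bseq R k | k in [set k | (1 <= k)%N]].

Definition set_pm (X : set int) (r : int) : set int :=
  [set x + r | x in X] `|` [set x - r | x in X].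

Definition Dset (R : realType) : set int :=
  [set 3 * aseq R k + k%:Z | k in [set k | (1 <= k)%N]].
Definition Cset (R : realType) : set int := set_pm (Dset R) 2.
Definition Sset (R : realType) : set int := set_pm (Cset R) 1.

(* The k-th smallest element, counted from k = 1, is the element x of X such
   that exactly k elements of X are at most x. When there is no such x the
   value is 0, which is in neither Aset nor Bset. *)
Definition kth_smallest (X : set int) (k : nat) : int :=
  xget 0 [set x | X x /\ [set y | X y /\ y <= x] #= `I_k].

Definition dseq (R : realType) (k : nat) : int := kth_smallest (Dset R) k.
Definition cseq (R : realType) (k : nat) : int := kth_smallest (Cset R) k.
Definition sseq (R : realType) (k : nat) : int := kth_smallest (Sset R) k.

Lemma kth_smallestE (X : set int) (k : nat) (x : int) :
  X x -> [set y | X y /\ y <= x] #= `I_k -> kth_smallest X k = x.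
Proof.
have uniq_lt (u v : int) : X u -> X v -> u < v ->
    [set y | X y /\ y <= u] #= `I_k ->
    [set y | X y /\ y <= v] #= `I_k -> False.
  move=> Xu Xv ltuv cu cv.
  have sub : v |` [set y | X y /\ y <= u] `<=` [set y | X y /\ y <= v].
    move=> y [->|[Xy leyu]]; first by split.
    by split=> //; apply: le_trans leyu (ltW ltuv).
  have cu1 : v |` [set y | X y /\ y <= u] #= `I_k.+1.
    have nv : v \notin [set y | X y /\ y <= u].
      by apply/negP; rewrite inE => -[_]; rewrite leNgt ltuv.
    apply/eq_cardSP; exists v; first by left.
    suff -> : (v |` [set y | X y /\ y <= u]) `\ v = [set y | X y /\ y <= u] by [].
    apply/seteqP; split=> [y [[->|//] /(_ erefl)] //|y uy].
    by split; [right|move=> yv; move: nv; rewrite -yv notin_setE].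
  have := subset_card_le sub.
  by rewrite (card_le_eqr cv) (card_le_eql cu1) card_le_II ltnn.
move=> Xx cx; rewrite /kth_smallest.
case: xgetP => [y _ [Xy cy]|/(_ x) []//].
by case: (ltgtP y x) => // lt; exfalso;
  [exact: uniq_lt lt cy cx|exact: uniq_lt lt cx cy].
Qed.

(* Main.v *)
(* Integers are split between A and B by the fractional part of n phi: it is
   below 2 - phi = phi^-2 on B and above it on A. The sequences have closed
   forms d(k) = 3 a(k) + k and c(k) = a(k) + 2k - 1 (because d(k) - 2 = c(a(k))
   and d(k) + 2 = c(a(k) + 1)), and s interleaves c(j) - 1 and c(j) + 1. Only
   the patterns with both c(k) and d(k) in B have to be excluded. Modulo 1,
   c(k) phi and d(k) phi are affine functions of x = {k phi}, namely
   (3 - phi) x - phi and (4 - 3 phi) x, and the ranges of x which they force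
   are separated by the common threshold 1 / (3 - phi). *)
Require Import Defs.
From mathcomp Require Import all_boot all_order all_algebra.
From mathcomp Require Import all_classical all_reals.
From mathcomp Require Import zify ring lra.

Import Order.TTheory GRing.Theory Num.Theory.
Local Open Scope classical_set_scope.

Section GoldenBeatty.
Variable R : realType.
Local Open Scope ring_scope.
Local Notation phi := (phi R).
Local Notation aseq := (aseq R).
Local Notation bseq := (Defs.bseq R).

Lemma phi_sqr : phi ^+ 2 = phi + 1.
Proof.
have h5 : Num.sqrt 5 ^+ 2 = 5 :> R by rewrite sqr_sqrtr ?ler0n.
rewrite /Defs.phi; set s := Num.sqrt 5 in h5 *.
by rewrite expr2 in h5; rewrite expr2; lra.
Qed.

(* With [x = k] and [a = floor (k phi)], this reads off [a phi] modulo 1. *)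
Lemma mul_phiE (a x : R) : a * phi = a + x - (x * phi - a) * (phi - 1).
Proof.
transitivity (a * phi + x * (phi + 1 - phi ^+ 2)); last by ring.
by rewrite phi_sqr; ring.
Qed.

Lemma phi_itv : 3 / 2 < phi < 5 / 3.
Proof.
have h5 : Num.sqrt 5 ^+ 2 = 5 :> R by rewrite sqr_sqrtr ?ler0n.
have h0 : 0 <= Num.sqrt 5 :> R by exact: sqrtr_ge0.
by rewrite /Defs.phi; set s := Num.sqrt 5 in h0 h5 *; nra.
Qed.

(** For nonzero [y] the exponent of 5 is even on the left and odd on the right. *)
Lemma sqr_eq_5sqr (x y : nat) : (x ^ 2 = 5 * y ^ 2)%N -> y = 0%N.
Proof.
case: y => [//|y] h; have := congr1 (fun z => odd (logn 5 z)) h.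
by rewrite lognM // !lognX oddD !oddM.
Qed.

Lemma phi_irrational (k : nat) (m : int) : k%:R * phi = m%:~R -> k = 0%N.
Proof.
move=> h.
(* Since 2 phi - 1 is the square root of 5, k phi = m gives 2m - k = k sqrt 5. *)
have e : (2 * m - k%:Z) ^+ 2 = 5 * k%:Z ^+ 2.
  apply/eqP; rewrite -(eqr_int R); apply/eqP.
  have p2 := phi_sqr; have hk : (k%:Z)%:~R = k%:R :> R by rewrite pmulrn.
  rewrite !(rmorphM, rmorphXn, rmorphB) /= -h hk.
  set x : R := k%:R; set p := phi in p2 *.
  transitivity (x ^+ 2 * (4 * p ^+ 2 - 4 * p + 1)); first by ring.
  by rewrite p2; ring.
by apply: (@sqr_eq_5sqr (absz (2 * m - k%:Z)%R)); lia.
Qed.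

Lemma aseq_itv k : (aseq k)%:~R <= k%:R * phi < (aseq k)%:~R + 1.
Proof. by have := floor_itv (k%:R * phi); rewrite intrD. Qed.

Lemma aseq_eq k (m : int) : m%:~R <= k%:R * phi < m%:~R + 1 -> aseq k = m.
Proof. by move=> h; apply: floor_def; rewrite intrD. Qed.

Lemma aseq_lt k : (0 < k)%N -> (aseq k)%:~R < k%:R * phi.
Proof.
move=> k0; have /andP[h _] := aseq_itv k; rewrite lt_neqAle h andbT.
by apply/eqP => /esym/phi_irrational k0'; rewrite k0' in k0.
Qed.

Lemma bseqE k : bseq k = aseq k + k%:Z.
Proof.
apply: floor_def; rewrite phi_sqr.
have := aseq_itv k; have hk : (k%:Z)%:~R = k%:R :> R by rewrite pmulrn.
by rewrite !intrD hk; lra.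
Qed.

Lemma ltr_addint (m n : int) : m%:~R < n%:~R + 1 :> R -> m <= n.
Proof. by rewrite -(intrD R n 1) ltr_int; lia. Qed.

Lemma aseq_step k : aseq k + 1 <= aseq k.+1.
Proof.
apply: ltr_addint; have := aseq_itv k; have := aseq_itv k.+1; have := phi_itv.
by rewrite intrD -natr1; lra.
Qed.

Lemma aseq0 : aseq 0 = 0.
Proof. by apply: aseq_eq; rewrite mul0r; lra. Qed.

Lemma aseq_ge k : k%:Z <= aseq k.
Proof.
elim: k => [|k IH]; first by rewrite aseq0.
by have := aseq_step k; lia.
Qed.

Lemma natr_abs (m : int) : 0 <= m -> `|m|%N%:R = m%:~R :> R.
Proof. by case: m. Qed.

(** With y = {k phi}, a(k) phi = a(k) + k - y (phi - 1). Irrationality makes y positive, so the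
    floor drops by exactly one. *)
Lemma aseq_aseq k : (0 < k)%N -> aseq `|aseq k| = aseq k + k%:Z - 1.
Proof.
move=> k0; apply: aseq_eq; rewrite natr_abs; last by have := aseq_ge k; lia.
have := aseq_lt k k0; have := aseq_itv k; have := phi_itv.
have hk : (k%:Z)%:~R = k%:R :> R by rewrite pmulrn.
rewrite !(intrD, intrB) hk (mul_phiE (aseq k)%:~R k%:R) => ph ha la.
set y := k%:R * phi - _; have : 0 < y < 1 by rewrite /y; lra.
by move: y => y; nra.
Qed.

Lemma aseq_aseqS k : aseq `|aseq k|.+1 = aseq k + k%:Z + 1.
Proof.
apply: aseq_eq; rewrite -natr1 natr_abs; last by have := aseq_ge k; lia.
have := aseq_itv k; have := phi_itv.
have hk : (k%:Z)%:~R = k%:R :> R by rewrite pmulrn.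
rewrite !intrD hk (mulrDl _ 1 phi) mul1r (mul_phiE (aseq k)%:~R k%:R) => ph ha.
set y := k%:R * phi - _; have : 0 <= y < 1 by rewrite /y; lra.
by move: y => y; nra.
Qed.

Lemma Aset_or_Bset (n : int) : 0 < n -> Aset R n \/ Bset R n.
Proof.
case: n => // n n0; have {}n0 : (0 < n)%N by [].
have ph := phi_itv; have p2 := phi_sqr; have ha := aseq_itv n.
have hn : (Posz n)%:~R = n%:R :> R by rewrite pmulrn.
have n1 : 1 <= n%:R :> R by rewrite ler1n.
have [hx|hx|hx] := ltgtP (n%:R * phi - (aseq n)%:~R) (2 - phi).
(* The witness is the ceiling of n / phi^2, because phi^-2 = 2 - phi. *)
- right; have hj : 0 < 2 * n%:Z - aseq n.
    by rewrite -(ltr0z R) intrB intrM hn; nra.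
  exists (absz (2 * n%:Z - aseq n)%R); first by rewrite /=; lia.
  rewrite bseqE gtz0_abs //.
  suff -> : aseq (absz (2 * n%:Z - aseq n)%R) = aseq n - n%:Z by lia.
  apply: aseq_eq; rewrite natr_abs; last exact: ltW.
  rewrite !intrB intrM hn; set a := (aseq n)%:~R in ha hx *.
  by rewrite expr2 in p2; nra.
(* The witness is the floor of n / phi plus one, the least j with j phi > n. *)
- left; have hj : 0 < aseq n - n%:Z + 1.
    by have := aseq_ge n; lia.
  exists (absz (aseq n - n%:Z + 1)%R); first by rewrite /=; lia.
  apply: aseq_eq; rewrite natr_abs; last exact: ltW.
  rewrite intrD intrB hn; set a := (aseq n)%:~R in ha hx *.
  by rewrite expr2 in p2; nra.
(* Equality would make (n + 1) phi an integer. *)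
- suff /phi_irrational : n.+1%:R * phi = (aseq n + 2)%:~R by [].
  by rewrite intrD -natr1; lra.
Qed.

(** For y = {j phi}, b(j) phi exceeds the integer b(j) + a(j) by y (2 - phi). *)
Lemma Bset_frac (n : int) : Bset R n ->
  exists m : int, m%:~R <= n%:~R * phi < m%:~R + (2 - phi).
Proof.
move=> [j _ <-]; exists (bseq j + aseq j); rewrite bseqE.
have ph := phi_itv; have ha := aseq_itv j.
have hj : (j%:Z)%:~R = j%:R :> R by rewrite pmulrn.
rewrite !intrD hj (mulrDl _ _ phi) (mul_phiE (aseq j)%:~R j%:R).
set y := j%:R * phi - _.
have -> : j%:R * phi = (aseq j)%:~R + y by rewrite /y; ring.
have : 0 <= y < 1 by rewrite /y; lra.
by move: y => y; nra.
Qed.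

Lemma not_Bset_both k :
  ~ (Bset R (aseq k + 2 * k%:Z - 1) /\ Bset R (3 * aseq k + k%:Z)).
Proof.
move=> [/Bset_frac[M hM] /Bset_frac[N hN]].
have ph := phi_itv; have p2 := phi_sqr; have ha := aseq_itv k.
have hk : (k%:Z)%:~R = k%:R :> R by rewrite pmulrn.
rewrite !(intrD, intrB, intrM) hk in hM hN.
pose x := k%:R * phi - (aseq k)%:~R.
have x0 : 0 <= x < 1 by rewrite /x; lra.
have kx : k%:R * phi = (aseq k)%:~R + x by rewrite /x; ring.
have ax := mul_phiE (aseq k)%:~R k%:R; rewrite -/x in ax.
(* Subtracting the integer parts of c(k) phi and d(k) phi leaves bounds in x alone, so few values of
   [m] and [n] survive. *)
pose m := M - k%:Z - 3 * aseq k; pose n := N - 3 * k%:Z - 4 * aseq k.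
have {}hM : m%:~R <= (3 - phi) * x - phi < m%:~R + (2 - phi).
  by rewrite /m !(intrB, intrM) hk; lra.
have {}hN : n%:~R <= (4 - 3 * phi) * x < n%:~R + (2 - phi).
  by rewrite /n !(intrB, intrM) hk; lra.
clearbody x m n; clear ha kx ax.
have : m <= -1 by apply: ltr_addint; nra.
have : -1 <= m by apply: ltr_addint; nra.
have : n <= 0 by apply: ltr_addint; nra.
have : -1 <= n by apply: ltr_addint; nra.
move=> n1 n2 m1 m2; have em : m = -1 by lia.
rewrite em in hM.
(* Here [m = -1] confines x to [(phi - 1) / (3 - phi), 1 / (3 - phi)). But [n = 0] forces x <= 0,
   and [n = -1] forces x > (phi - 1) / (3 phi - 4), which equals 1 / (3 - phi). *)
have [en|en] : n = 0 \/ n = -1 by lia.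
  by rewrite en in hN; nra.
by rewrite en in hN; nra.
Qed.

(** The elements up to [f k] are the images of 0, ..., k, hence k + 1 in number; this accounts for
    the index shift. *)
Lemma kth_smallest_incr (f : nat -> int) (X : set int) (k : nat) :
    (forall i, f i < f i.+1) -> X = range f ->
  kth_smallest X k.+1 = f k.
Proof.
move=> fS ->; have f_lt : {homo f : i j / (i < j)%N >-> i < j}.
  by apply: homo_ltn => //; exact: lt_trans.
have f_le : {mono f : i j / (i <= j)%N >-> i <= j} by exact: le_mono.
apply: kth_smallestE; first by exists k.
suff -> : [set y | range f y /\ y <= f k] = f @` `I_k.+1.
  by apply: inj_card_eq => i j _ _; exact: inc_inj.
apply/seteqP; split=> [_ [[i _ <-] ik]|_ [i /= ik <-]]; last first.
  by split; [exists i|rewrite f_le -ltnS].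
by exists i => //=; rewrite ltnS -f_le.
Qed.

Definition cformula (k : nat) : int := aseq k + 2 * k%:Z - 1.

Lemma DsetE : Dset R = range (fun i => 3 * aseq i.+1 + i.+1%:Z).
Proof.
apply/seteqP; split=> [_ [[//|k] _ <-]|_ [k _ <-]]; first by exists k.
by exists k.+1.
Qed.

Lemma CsetE : Cset R = range (fun i => cformula i.+1).
Proof.
apply/seteqP; split=> [_ [[_ [k /= k0 <-] <-]|[_ [k /= k0 <-] <-]]|_ [k _ <-]].
- exists `|aseq k|%N => //; rewrite /cformula aseq_aseqS.
  by have := aseq_ge k; lia.
- have ak := aseq_ge k; exists `|aseq k|.-1 => //.
  by rewrite /cformula prednK ?aseq_aseq //; lia.
(* An index a(j) yields d(j) - 2, and an index b(j) yields d(a(j)) + 2. *)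
- have [[j /= j0 jk]|[j /= j0 jk]] := Aset_or_Bset k.+1%:Z isT.
    right; exists (3 * aseq j + j%:Z); first by exists j.
    by have := aseq_aseq j j0; rewrite /cformula jk /= => ->; lia.
  (* b(j) = a(a(j)) + 1 *)
  have aj := aseq_ge j; have aaj := aseq_aseq j j0.
  have aaj_ge := aseq_ge `|aseq j|.
  have {jk} aaj_k : aseq `|aseq j| = k%:Z by rewrite bseqE in jk; lia.
  left; exists (3 * aseq `|aseq j| + `|aseq j|%:Z).
    by exists `|aseq j|%N => //=; lia.
  by have := aseq_aseqS `|aseq j|; rewrite /cformula aaj_k /= => ->; lia.
Qed.

(** A gap of 3 keeps c(k) + 1 strictly below c(k + 1) - 1, so the interleaving in [sformula] is
    increasing. *)
Lemma cformula_step k : cformula k + 3 <= cformula k.+1.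
Proof. by rewrite /cformula; have := aseq_step k; lia. Qed.

Definition sformula (i : nat) : int :=
  cformula i./2.+1 + (if odd i then 1 else -1).

Lemma SsetE : Sset R = range sformula.
Proof.
rewrite /Sset CsetE; apply/seteqP.
split=> [_ [[_ [k _ <-] <-]|[_ [k _ <-] <-]]|_ [k _ <-]].
- by exists k.*2.+1 => //; rewrite /sformula /= odd_double uphalf_double.
- by exists k.*2 => //; rewrite /sformula odd_double doubleK.
- rewrite /sformula; case: odd; [left|right];
    exists (cformula k./2.+1) => //; by exists k./2.
Qed.

Lemma sformula_step i : sformula i < sformula i.+1.
Proof.
rewrite /sformula /= uphalf_half; case: odd => /=; last by rewrite add0n; lia.
by have := cformula_step i./2.+1; rewrite add1n; lia.
Qed.

Lemma sformula_gt0 i : 0 < sformula i.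
Proof.
rewrite /sformula /cformula; have := aseq_ge i./2.+1.
by case: odd; lia.
Qed.

End GoldenBeatty.

Theorem theorem4p8 (R : realType) (k : nat) (hk : (1 <= k)%N) :
  ((Aset R `*` Aset R `*` Aset R) `|` (Aset R `*` Aset R `*` Bset R) `|`
   (Aset R `*` Bset R `*` Aset R) `|` (Bset R `*` Aset R `*` Aset R) `|`
   (Bset R `*` Bset R `*` Aset R) `|` (Bset R `*` Aset R `*` Bset R))
  (sseq R k, cseq R k, dseq R k).
Proof.
case: k hk => // k _.
have -> : sseq R k.+1 = sformula R k.
  exact: kth_smallest_incr (sformula_step R) (SsetE R).
have -> : cseq R k.+1 = cformula R k.+1.
  apply: kth_smallest_incr (CsetE R) => i.
  by have := cformula_step R i.+1; lia.
have -> : dseq R k.+1 = (3 * aseq R k.+1 + k.+1%:Z)%R.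
  apply: kth_smallest_incr (DsetE R) => i.
  by have := aseq_step R i.+1; lia.
have ak := aseq_ge R k.+1.
have hs := Aset_or_Bset R _ (sformula_gt0 R k).
have hc : Aset R (cformula R k.+1) \/ Bset R (cformula R k.+1).
  by apply: Aset_or_Bset; rewrite /cformula; lia.
have hd : Aset R (3 * aseq R k.+1 + k.+1%:Z)%R \/
    Bset R (3 * aseq R k.+1 + k.+1%:Z)%R.
  by apply: Aset_or_Bset; lia.
(* The six listed patterns are all eight except those with B in both the second and third places. *)
have := not_Bset_both R k.+1; rewrite -/(cformula R k.+1) /setU /setX /=.
by tauto.
Qed.
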